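(* Let $\mathcal P$ be a property of filtrations satisfying hypotheses (HR0), (HR1), (HR2) of the context, and let $G$ be a group. The following properties are equivalent: (a) the group $G$ is residually $\mathcal R_{\mathcal P}$; (b) the filtration $\gamma_*^{\mathcal P}(G)$ is separating, that is, $\bigcap_{n\ge1}\gamma_n^{\mathcal P}(G)=\{1\}$; (c) there exists a separating $\mathcal P$-filtration $G_*$ such that $G=G_1$.
   Context: A filtration $G_*$ on a group $G$ is a sequence of subgroups $G=G_1\supseteq G_2\supseteq\cdots$; it is separating if $\bigcap_{n\ge1}G_n=\{1\}$. Inclusion of filtrations is termwise. A $\mathcal P$-filtration is a filtration satisfying $\mathcal P$. The hypotheses are: (HR0) If $f\colon K\to G$ is a group morphism and $G_*$ is a $\mathcal P$-filtration on $G$, then $f^{-1}(G_* )$ is a $\mathcal P$-filtration on $K$. (HR1) If $G_*$ is a $\mathcal P$-filtration, then for every $n\ge1$, $G_*/G_n$ (the filtration of $G_1/G_n$ by the images of the $G_i$; the $G_n$ are normal in $G_1$) is a $\mathcal P$-filtration on $G_1/G_n$. (HR2) For every group $G$ there is a smallest $\mathcal P$-filtration $\gamma_*^{\mathcal P}(G)$ such that $\gamma_1^{\mathcal P}(G)=G$. $\mathcal R_{\mathcal P}$ is the class of groups $G$ satisfying $\gamma_n^{\mathcal P}(G)=\{1\}$ for some $n\ge1$. A group $G$ is residually $\mathcal R$, for a class $\mathcal R$ of groups, if for every $g\in G$, $g\ne1$, there exist $Q\in\mathcal R$ and an epimorphism $\psi\colon G\to Q$ with $\psi(g)\ne1$.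 *)

(* Defs.v *)
From HB Require Import structures.
From mathcomp Require Import all_boot.
From mathcomp Require Import boolp classical_sets.

Set Implicit Arguments.
Unset Strict Implicit.
Unset Printing Implicit Defensive.

Local Open Scope classical_set_scope.
Local Open Scope group_scope.

Definition is_subgroup (G : groupType) (A : set G) : Prop :=
  group_closed [in A].

Record normal_subgroup (G : groupType) := NormalSubgroup {
  nsub_set : set G;
  nsub_group : is_subgroup nsub_set;
  nsub_normal : forall x y : G, nsub_set x -> nsub_set (x ^ y)
}.

Section SubgroupTheory.
Variables (G : groupType) (A : set G).
Hypothesis gA : is_subgroup A.

Lemma subgroup1 : A 1.
Proof. by case: gA => A1 _; move: A1; rewrite !inE. Qed.

Lemma subgroupF x y : A x -> A y -> A (x / y).
Proof.
case: gA => _ Adiv Ax Ay.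
by have := Adiv x y; rewrite !inE; apply.
Qed.

Lemma subgroupV x : A x -> A x^-1.
Proof.
by move=> Ax; rewrite -div1g; apply: subgroupF => //; apply: subgroup1.
Qed.

Lemma subgroupM x y : A x -> A y -> A (x * y).
Proof. by move=> Ax Ay; rewrite -[y]invgK; apply/subgroupF/subgroupV. Qed.

End SubgroupTheory.

Lemma is_subgroupI (G : groupType) (A : set G) :
  A 1 -> (forall x y, A x -> A y -> A (x / y)) -> is_subgroup A.
Proof.
move=> A1 Adiv; split; first by rewrite inE.
by move=> x y; rewrite !inE; apply: Adiv.
Qed.

Section QuotientGroup.
Variables (G : groupType) (N : normal_subgroup G).

Definition coset_rel (x y : G) : bool := x^-1 * y \in nsub_set N.

Lemma coset_relP x y : reflect (nsub_set N (x^-1 * y)) (coset_rel x y).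
Proof. by apply: (iffP idP); rewrite /coset_rel inE. Qed.

Lemma coset_rel_refl : reflexive coset_rel.
Proof.
by move=> x; apply/coset_relP; rewrite mulVg; exact: (subgroup1 (nsub_group N)).
Qed.

Lemma coset_rel_sym : symmetric coset_rel.
Proof.
have H x y : coset_rel x y -> coset_rel y x.
  move=> /coset_relP Nxy; apply/coset_relP.
  by have := subgroupV (nsub_group N) Nxy; rewrite invgM invgK.
by move=> x y; apply/idP/idP; apply: H.
Qed.

Lemma coset_rel_trans : transitive coset_rel.
Proof.
move=> y x z /coset_relP Nxy /coset_relP Nyz; apply/coset_relP.
by have := subgroupM (nsub_group N) Nxy Nyz; rewrite -mulgA mulVKg.
Qed.

Canonical coset_equiv :=
  EquivRel coset_rel coset_rel_refl coset_rel_sym coset_rel_trans.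

Definition quot_group := {eq_quot coset_equiv}%qT.

HB.instance Definition _ := Choice.on quot_group.
HB.instance Definition _ := EqQuotient.on quot_group.

Local Open Scope quotient_scope.

Definition quot_proj (x : G) : quot_group := \pi_quot_group x.

Lemma quot_projP x y : quot_proj x = quot_proj y <-> nsub_set N (x^-1 * y).
Proof. by split=> [/eqmodP/coset_relP|/coset_relP H] //; apply/eqmodP. Qed.

Lemma quot_projK (q : quot_group) : quot_proj (repr q) = q.
Proof. exact: reprK. Qed.

Definition quot_one : quot_group := quot_proj 1.
Definition quot_inv (q : quot_group) : quot_group := quot_proj (repr q)^-1.
Definition quot_mul (q r : quot_group) : quot_group :=
  quot_proj (repr q * repr r).

Lemma quot_proj_inv x : quot_inv (quot_proj x) = quot_proj x^-1.
Proof.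
apply/quot_projP; rewrite invgK.
have /quot_projP H := quot_projK (quot_proj x).
set y := repr _ in H *.
have := subgroupV (nsub_group N) (nsub_normal y^-1 H).
by rewrite /conjg invgK -mulgA mulVKg invgM invgK.
Qed.

Lemma quot_proj_mul x y :
  quot_mul (quot_proj x) (quot_proj y) = quot_proj (x * y).
Proof.
apply/quot_projP.
have /quot_projP Hx := quot_projK (quot_proj x).
have /quot_projP Hy := quot_projK (quot_proj y).
set x' := repr (quot_proj x) in Hx *; set y' := repr (quot_proj y) in Hy *.
have := subgroupM (nsub_group N) (nsub_normal y' Hx) Hy.
by rewrite /conjg invgM !mulgA mulgK.
Qed.

Lemma quot_mulA : associative quot_mul.
Proof.
move=> q r s; rewrite -[q]quot_projK -[r]quot_projK -[s]quot_projK.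
by rewrite !quot_proj_mul mulgA.
Qed.

Lemma quot_1mul : left_id quot_one quot_mul.
Proof. by move=> q; rewrite -[q]quot_projK quot_proj_mul mul1g. Qed.

Lemma quot_mul1 : right_id quot_one quot_mul.
Proof. by move=> q; rewrite -[q]quot_projK quot_proj_mul mulg1. Qed.

Lemma quot_Vmul : left_inverse quot_one quot_inv quot_mul.
Proof.
by move=> q; rewrite -[q]quot_projK quot_proj_inv quot_proj_mul mulVg.
Qed.

Lemma quot_mulV : right_inverse quot_one quot_inv quot_mul.
Proof.
by move=> q; rewrite -[q]quot_projK quot_proj_inv quot_proj_mul mulgV.
Qed.

HB.instance Definition _ := isGroup.Build quot_group
  quot_mulA quot_1mul quot_mul1 quot_Vmul quot_mulV.

Lemma quot_projF : {morph quot_proj : x y / x / y}.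
Proof. by move=> x y; rewrite -quot_proj_mul -quot_proj_inv. Qed.

HB.instance Definition _ :=
  isGroupMorphism.Build G quot_group quot_proj quot_projF.

Lemma quot_proj_surj (q : quot_group) : exists x, quot_proj x = q.
Proof. by exists (repr q); apply: quot_projK. Qed.

End QuotientGroup.

(* Terms are indexed from 1. The sequence is total on nat, but the value at 0
   carries no information: [filt_dec] and [filt_top] force F 0 = [set: G]. *)
Record filtration (G : groupType) := Filtration {
  filt_term :> nat -> set G;
  filt_group : forall n, is_subgroup (filt_term n);
  filt_top : filt_term 1%N = [set: G];
  filt_dec : forall n, filt_term n.+1 `<=` filt_term n
}.

Definition filt_le (G : groupType) (E F : filtration G) : Prop :=
  forall n, (1 <= n)%N -> E n `<=` F n.

Definition separating (G : groupType) (F : filtration G) : Prop :=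
  \bigcap_(n in [set n | (1 <= n)%N]) F n = [set 1].

Section Preimage.
Variables (K G : groupType) (f : UMagmaMorphism.type K G) (F : filtration G).

Lemma preim_group n : is_subgroup (f @^-1` F n).
Proof.
apply: is_subgroupI => [|x y /= Fx Fy].
  by rewrite /= gmulf1; exact: (subgroup1 (filt_group F n)).
by rewrite gmulfF; apply: subgroupF => //; apply: filt_group.
Qed.

Lemma preim_top : f @^-1` F 1%N = [set: K].
Proof. by rewrite filt_top preimage_setT. Qed.

Lemma preim_dec n : f @^-1` F n.+1 `<=` f @^-1` F n.
Proof. by move=> x; apply: filt_dec. Qed.

Definition preim_filtration : filtration K :=
  Filtration preim_group preim_top preim_dec.

End Preimage.

Section QuotientFiltration.
Variables (G : groupType) (F : filtration G) (N : normal_subgroup G).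

Lemma quot_filt_group n : is_subgroup (quot_proj N @` F n).
Proof.
apply: is_subgroupI => [|_ _ [x Fx <-] [y Fy <-]].
  by exists 1; [exact: (subgroup1 (filt_group F n)) | apply: gmulf1].
by exists (x / y); [apply: subgroupF => //; apply: filt_group | apply: gmulfF].
Qed.

Lemma quot_filt_top : quot_proj N @` F 1%N = [set: quot_group N].
Proof.
apply/seteqP; split=> // q _; have [x <-] := quot_proj_surj q.
by exists x; rewrite // filt_top.
Qed.

Lemma quot_filt_dec n : quot_proj N @` F n.+1 `<=` quot_proj N @` F n.
Proof. by move=> _ [x Fx <-]; exists x => //; apply: filt_dec. Qed.

Definition quot_filtration : filtration (quot_group N) :=
  Filtration quot_filt_group quot_filt_top quot_filt_dec.

End QuotientFiltration.

Definition filtration_property : Type :=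
  forall G : groupType, filtration G -> Prop.

Definition HR0 (P : filtration_property) : Prop :=
  forall (K G : groupType) (f : UMagmaMorphism.type K G) (F : filtration G),
    P G F -> P K (preim_filtration f F).

(* The normality of the terms of a P-filtration is part of the hypothesis:
   [N] is [F n] equipped with a proof of normality. Since F 1 is the whole
   group, the quotient F 1 / F n is a quotient of the type G itself. *)
Definition HR1 (P : filtration_property) : Prop :=
  forall (G : groupType) (F : filtration G), P G F ->
  forall n, (1 <= n)%N ->
  exists N : normal_subgroup G,
    nsub_set N = F n /\ P (quot_group N) (quot_filtration F N).

Definition is_smallest (P : filtration_property) (G : groupType)
    (F : filtration G) : Prop :=
  P G F /\ forall E : filtration G, P G E -> filt_le F E.

(* The condition gamma_1 = G is part of the type [filtration G]. *)
Definition HR2 (P : filtration_property) : Prop :=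
  forall G : groupType, exists F : filtration G, is_smallest P F.

Definition gamma (P : filtration_property) (hr2 : HR2 P) (G : groupType) :
    filtration G :=
  sval (cid (hr2 G)).

Definition group_class : Type := groupType -> Prop.

Definition RP (P : filtration_property) (hr2 : HR2 P) : group_class :=
  fun G => exists2 n, (1 <= n)%N & gamma hr2 G n = [set 1].

(* Epimorphisms of groups are taken to be the surjective morphisms. *)
Definition residually (R : group_class) (G : groupType) : Prop :=
  forall g : G, g <> 1 ->
  exists (Q : groupType) (psi : UMagmaMorphism.type G Q),
    R Q /\ (forall q : Q, exists x : G, psi x = q) /\ psi g <> 1.

(* Main.v *)
Require Import Defs.
From HB Require Import structures.
From mathcomp Require Import all_boot.
From mathcomp Require Import boolp classical_sets.

(** Write [gamma] for the smallest P-filtration and say that [Q] is P-nilpotent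
    when some [gamma Q n] is trivial. Two facts carry the equivalence.

    Minimality together with stability under preimages makes [gamma] functorial:
    a morphism [G -> Q] sends [gamma G n] into [gamma Q n] ([gamma_functorial]).
    Hence an element lying in every [gamma G n] is killed by every morphism to a
    P-nilpotent group, so it is trivial when such morphisms separate points.

    Conversely, if [F] is a P-filtration of [G], then [G / F n] is P-nilpotent
    ([quot_term_RP]): the image filtration is a P-filtration whose n-th term is
    trivial, and [gamma] lies below it. When [F] is separating, the projections
    to the [G / F n] detect every nontrivial element. A separating [gamma G]
    is in particular a separating P-filtration, which closes the cycle. *)

Local Open Scope classical_set_scope.
Local Open Scope group_scope.

Lemma separatingP (G : groupType) (F : filtration G) :
  separating F <-> forall g, (forall n, (1 <= n)%N -> F n g) -> g = 1.
Proof.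
split=> [sepF g Fg | Fsep].
  by have : [set 1] g by rewrite -sepF.
apply/seteqP; split=> [g Fg | _ -> n _]; first exact: Fsep.
exact: (subgroup1 (filt_group F n)).
Qed.

Lemma gamma_P (P : filtration_property) (hr2 : HR2 P) (G : groupType) :
  P G (gamma hr2 G).
Proof. by rewrite /gamma; case: cid => F /= []. Qed.

Lemma gamma_le {P : filtration_property} (hr2 : HR2 P) {G : groupType}
    {F : filtration G} : P G F -> filt_le (gamma hr2 G) F.
Proof. by rewrite /gamma; case: cid => E /= [_ minE] /minE. Qed.

(** The preimage of [gamma Q] is a P-filtration of [G], hence lies above
    [gamma G]. *)
Lemma gamma_functorial (P : filtration_property) (hr0 : HR0 P) (hr2 : HR2 P)
    (G Q : groupType) (f : UMagmaMorphism.type G Q) (n : nat) :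
  (1 <= n)%N -> gamma hr2 G n `<=` f @^-1` gamma hr2 Q n.
Proof.
apply: (gamma_le hr2 (F := preim_filtration f (gamma hr2 Q))).
by apply: hr0; apply: gamma_P.
Qed.

Lemma quot_proj_eq1 {G : groupType} {N : normal_subgroup G} {x : G} :
  quot_proj N x = 1 <-> nsub_set N x.
Proof.
have := quot_projP N 1 x; rewrite invg1 mul1g gmulf1 => <-.
by split=> ->.
Qed.

(** The image of [F n] in [G / F n] is trivial, and it bounds the n-th term of
    [gamma (G / F n)] by minimality. *)
Lemma quot_term_RP {P : filtration_property} (hr2 : HR2 P) {G : groupType}
    {F : filtration G} {n : nat} {N : normal_subgroup G} :
  (1 <= n)%N -> nsub_set N = F n -> P (quot_group N) (quot_filtration F N) ->
  RP hr2 (quot_group N).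
Proof.
move=> n_gt0 NF PQ; exists n => //; apply/seteqP; split=> [q | _ ->].
  by move=> /(gamma_le hr2 PQ n n_gt0)[x Fx <-]; apply/quot_proj_eq1; rewrite NF.
exact: (subgroup1 (filt_group _ n)).
Qed.

Theorem lemma7p5 (P : filtration_property)
    (hr0 : HR0 P) (hr1 : HR1 P) (hr2 : HR2 P) (G : groupType) :
  [<-> residually (RP hr2) G;
       separating (gamma hr2 G);
       exists F : filtration G, P G F /\ separating F].
Proof.
tfae.
- move=> resG; apply/separatingP => g Gg; apply: contrapT => /resG.
  move=> [Q [psi [[n n_gt0 Qn1] [_]]]]; apply.
  have : gamma hr2 Q n (psi g) by apply: gamma_functorial (Gg n n_gt0).
  by rewrite Qn1.
- by move=> sepG; exists (gamma hr2 G); split=> //; apply: gamma_P.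
- move=> [F [PF /separatingP sepF]] g g_neq1.
  have [n n_gt0 Fng] : exists2 n, (1 <= n)%N & ~ F n g.
    apply: contrapT => noF; apply/g_neq1/sepF => n n_gt0.
    by apply: contrapT => Fng; apply: noF; exists n.
  have [N [NF PQ]] := hr1 G F PF n n_gt0.
  exists (quot_group N), (quot_proj N); split.
    exact (quot_term_RP hr2 n_gt0 NF PQ).
  split; first exact: quot_proj_surj.
  by move=> /quot_proj_eq1; rewrite NF.
Qed.
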